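(* Let $0<b<1$ and $x^*=\frac{1}{b-1}$. Consider the functional equation $y(x+1)=y(bx)$. (i) If $x_0>x^*$, then for every function $y_0:[bx_0,\,x_0+1)\to\mathbb{R}$ the initial value problem for the functional equation with initial condition $y(x)=y_0(x)$ for $x\in[bx_0,\,x_0+1)$ has a unique solution on $(bx^*,\infty)$. (ii) If $x_0<x^*$, then for every function $y_0:[x_0+1,\,bx_0)\to\mathbb{R}$ the initial value problem for the functional equation with initial condition $y(x)=y_0(x)$ for $x\in[x_0+1,\,bx_0)$ has a unique solution on $(-\infty,bx^* )$. (iii) Let $c<x^*$ and $d>x^*$. For all functions $f:[c+1,\,bc)\to\mathbb{R}$ and $g:[bd,\,d+1)\to\mathbb{R}$, the initial value problem for the functional equation with initial conditions $y(x)=f(x)$ for $x\in[c+1,\,bc)$ and $y(x)=g(x)$ for $x\in[bd,\,d+1)$ has a unique solution on $\mathbb{R}\setminus\{bx^*\}$.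
   Context: A solution of the initial value problem on a set $J\subseteq\mathbb{R}$ is a function $y:J\to\mathbb{R}$ that satisfies $y(x+1)=y(bx)$ for all real $x$ with $x+1\in J$ and $bx\in J$, and agrees with the prescribed initial functions on their domains. No continuity is assumed. The point $x^*=\frac1{b-1}$ is the solution of $x+1=bx$, so $bx^*=x^*+1$. *)

(* Defs.v *)
From HB Require Import structures.
From mathcomp Require Import all_boot all_order all_algebra.
From mathcomp Require Import boolp classical_sets set_interval reals.

Set Implicit Arguments.
Unset Strict Implicit.
Unset Printing Implicit Defensive.

Import Order.TTheory GRing.Theory Num.Theory.
Local Open Scope classical_set_scope.
Local Open Scope ring_scope.

Definition xstar (R : realType) (b : R) : R := 1 / (b - 1).

(* A partial function on a set J of reals is a function on the subtype
   [set_type J], so that equality of such functions is equality on J.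
   y (x + 1) = y (b * x) for all real x with x + 1 and b * x in J: the points
   u and v of J stand for x + 1 and b * x together with their membership. *)
Definition solves (R : realType) (b : R) (J : set R) (y : J -> R) : Prop :=
  forall (x : R) (u v : J), \val u = x + 1 -> \val v = b * x -> y u = y v.

(* The existential makes the inclusion of I in J part of the condition. *)
Definition agrees (R : realType) (J I : set R) (y : J -> R) (y0 : I -> R) :
    Prop :=
  forall t : I, exists2 u : J, \val u = \val t & y u = y0 t.

(* Main.v *)
(** In the coordinate [s = t - b x*] the points [x + 1] and [b x] become [s]
    and [b s], so a solution is exactly a function that is constant on the
    orbits of [s |-> b s].  Each interval carrying initial data is, up to sign,
    [[b r, r[] or []b r, r]] with [r > 0], and meets every orbit on its side
    of the fixed point exactly once; a solution is therefore freely and uniquely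
    determined by its values there. *)

Require Import Defs.
From HB Require Import structures.
From mathcomp Require Import all_boot all_order all_algebra.
From mathcomp Require Import boolp classical_sets set_interval reals.
From mathcomp Require Import topology normedtype sequences ring lra.

Set Implicit Arguments.
Unset Strict Implicit.
Unset Printing Implicit Defensive.

Import Order.TTheory GRing.Theory Num.Theory.
Import numFieldNormedType.Exports.
Local Open Scope classical_set_scope.
Local Open Scope ring_scope.

(** * Orbits of the homothety of centre [p] and ratio [b], under integer iterates *)

Definition same_orbit (R : realType) (b p t t' : R) : Prop :=
  exists k : int, t' - p = b ^ k * (t - p).

Definition orbit_closed (R : realType) (b p : R) (J : set R) : Prop :=
  forall t t', same_orbit b p t t' -> J t -> J t'.

Definition transversal (R : realType) (b p : R) (J I : set R) : Prop :=
  [/\ I `<=` J,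
      forall t, J t -> exists2 t', I t' & same_orbit b p t t'
    & forall t t', I t -> I t' -> same_orbit b p t t' -> t = t'].

Section Orbits.
Variables (R : realType) (b : R).
Hypothesis b_gt0 : 0 < b.
Implicit Types p t : R.

Lemma same_orbit_refl p t : same_orbit b p t t.
Proof. by exists 0; rewrite expr0z mul1r. Qed.

Lemma same_orbit_sym p t t' : same_orbit b p t t' -> same_orbit b p t' t.
Proof.
move=> [k e]; exists (- k).
by rewrite e mulrA -expfzDr ?gt_eqF// addNr expr0z mul1r.
Qed.

Lemma same_orbit_trans p t1 t2 t3 :
  same_orbit b p t1 t2 -> same_orbit b p t2 t3 -> same_orbit b p t1 t3.
Proof.
by move=> [k e] [l e']; exists (l + k); rewrite e' e mulrA -expfzDr ?gt_eqF.
Qed.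

Lemma orbit_closed_gt p : orbit_closed b p `]p, +oo[.
Proof.
move=> t t' [k e]; rewrite /= !in_itv /= !andbT -!(subr_gt0 p) e.
by rewrite pmulr_rgt0 // exprz_gt0.
Qed.

Lemma orbit_closed_lt p : orbit_closed b p `]-oo, p[.
Proof.
move=> t t' [k e]; rewrite /= !in_itv /= -!(subr_lt0 p) e.
by rewrite pmulr_rlt0 // exprz_gt0.
Qed.

Lemma orbit_closed_neq p : orbit_closed b p (~` [set p]).
Proof.
move=> t t' [k e] tp /eqP; rewrite -subr_eq0 e mulf_eq0 gt_eqF ?exprz_gt0//=.
by rewrite subr_eq0 => /eqP.
Qed.

(** * Powers of [b] and half-open windows of ratio [b] *)

Hypothesis b_lt1 : b < 1.

Lemma exists_expr_lt (e : R) : 0 < e -> exists n : nat, b ^+ n < e.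
Proof.
move=> e0; have b1 : `|b| < 1 by rewrite gtr0_norm.
have /cvgrPdist_lt cvg_b := cvg_expr b1.
have [n _ /(_ n (leqnn n))] := cvg_b e e0.
by rewrite sub0r normrN gtr0_norm ?exprn_gt0//; exists n.
Qed.

Lemma exists_exprz_itvco (s r : R) : 0 < s -> 0 < r ->
  exists k : int, b * r <= b ^ k * s < r.
Proof.
move=> s0 r0; have [rs|sr] := leP r s.
  have [|n0 n0P] := @exists_expr_lt (r / s); first exact: divr_gt0.
  (* The least [n] that brings [s] below [r] cannot have jumped over the window: one factor [b]
     fewer leaves a value at least [r]. *)
  have [|n nP nmin] := @ex_minnP (fun n => b ^+ n * s < r).
    by exists n0; rewrite -ltr_pdivlMr.
  case: n => [|n] in nP nmin *.
    by move: nP; rewrite expr0 mul1r ltNge rs.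
  exists n.+1%:Z; apply/andP; split; last by [].
  rewrite -exprnP exprS -mulrA ler_pM2l// leNgt.
  by apply/negP => /nmin; rewrite ltnn.
have [|n0 n0P] := @exists_expr_lt (s / r); first exact: divr_gt0.
have [|n nP nmin] := @ex_minnP (fun n => b ^+ n * r <= s).
  by exists n0; rewrite -ler_pdivlMr// ltW.
case: n => [|n] in nP nmin *.
  by move: nP; rewrite expr0 mul1r leNgt sr.
(* The least exponent is [n.+1]: [b ^+ n.+1 * r <= s] is the lower bound after division by [b ^+ n],
   and failure at [n] gives the strict upper bound. *)
exists (- n%:Z); rewrite -invr_expz -exprnP.
have bn0 : 0 < b ^+ n by rewrite exprn_gt0.
rewrite [_^-1 * s]mulrC ler_pdivlMr// ltr_pdivrMr// -mulrA [r * _]mulrC mulrA.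
rewrite -exprS nP ltNge; apply/negP => /nmin.
by rewrite ltnn.
Qed.

(** Exchanging [s] and [r] in the previous lemma inverts the ratio, which moves the closed end of
    the window to the other side; the exponent becomes [1 - k]. *)
Lemma exists_exprz_itvoc (s r : R) : 0 < s -> 0 < r ->
  exists k : int, b * r < b ^ k * s <= r.
Proof.
move=> s0 r0; have [k /andP[le lt]] := exists_exprz_itvco r0 s0.
exists (1 - k); have bk0 : 0 < b ^ k by exact: exprz_gt0.
rewrite expfzDr ?gt_eqF// expr1z -invr_expz -mulrA [_^-1 * s]mulrC.
rewrite ltr_pM2l// mulrA ltr_pdivlMr// ler_pdivrMr//.
by rewrite [r * _]mulrC lt le.
Qed.

(** The hypotheses say [b < b ^ k < b^-1], which leaves only [k = 0]. Being strict and symmetric,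
    they hold for two points of one window, whichever of its ends is closed. *)
Lemma exprz_mul_close (s : R) (k : int) : 0 < s ->
  b * s < b ^ k * s -> b * (b ^ k * s) < s -> k = 0.
Proof.
move=> s0; rewrite ltr_pM2r// => b_lt.
rewrite mulrA -[ltRHS]mul1r ltr_pM2r// => lt_bV; move: k b_lt lt_bV.
have bn n : b ^+ n <= 1 by rewrite exprn_ile1// ltW.
case=> [[|n]|n] //.
  by rewrite -exprnP exprS ltr_pMr// ltNge bn.
move=> _; rewrite NegzE -invr_expz -exprnP exprS invfM mulVKf ?gt_eqF//.
by rewrite invf_lt1 ?exprn_gt0// ltNge bn.
Qed.

(** * Transversals of the half-lines and of unions *)

Lemma transversal_gt p (r : R) : 0 < r ->
  transversal b p `]p, +oo[ `[p + b * r, p + r[.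
Proof.
move=> r0; have br0 : 0 < b * r by exact: mulr_gt0.
split=> [t|t|t t'] /=; rewrite !in_itv /= ?andbT.
- by move=> /andP[]; lra.
- rewrite -subr_gt0 => t0; have [k /andP[le lt]] := exists_exprz_itvco t0 r0.
  exists (p + b ^ k * (t - p)); last by exists k; ring.
  by rewrite in_itv /= lerD2l ltrD2l le.
- move=> /andP[lt tl] /andP[lt' tl'] [k e].
  have tp : 0 < t - p by lra.
  have k0 : k = 0.
    by apply: (exprz_mul_close tp); rewrite -e; nra.
  by move: e; rewrite k0 expr0z mul1r => /addIr.
Qed.

Lemma transversal_lt p (r : R) : 0 < r ->
  transversal b p `]-oo, p[ `[p - r, p - b * r[.
Proof.
move=> r0; have br0 : 0 < b * r by exact: mulr_gt0.
split=> [t|t|t t'] /=; rewrite !in_itv /=.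
- by move=> /andP[]; lra.
(* Reflection in [p] turns the interval into []b * r, r]], hence the window closed on the right. *)
- rewrite -subr_gt0 => t0; have [k /andP[lt le]] := exists_exprz_itvoc t0 r0.
  exists (p - b ^ k * (p - t)); last by exists k; ring.
  by rewrite in_itv /= lerD2l lerN2 ltrD2l ltrN2 le.
- move=> /andP[lt tl] /andP[lt' tl'] [k e].
  have pt : 0 < p - t by lra.
  have e' : p - t' = b ^ k * (p - t) by rewrite -opprB e; ring.
  have k0 : k = 0.
    by apply: (exprz_mul_close pt); rewrite -e'; nra.
  by move: e; rewrite k0 expr0z mul1r => /addIr.
Qed.

(** No orbit passes from [J1] to [J2], as both are closed and they are disjoint, so points of [I1]
    and [I2] are never on a common orbit. *)
Lemma transversalU p (J1 J2 I1 I2 : set R) :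
  orbit_closed b p J1 -> orbit_closed b p J2 -> J1 `&` J2 = set0 ->
  transversal b p J1 I1 -> transversal b p J2 I2 ->
  transversal b p (J1 `|` J2) (I1 `|` I2).
Proof.
move=> J1c J2c J12 [I1J1 ex1 uq1] [I2J2 ex2 uq2].
have J12F t : J1 t -> J2 t -> False.
  by move=> J1t J2t; have : (J1 `&` J2) t by []; rewrite J12.
split=> [|t [/ex1|/ex2] [t' It' tt']|t t' [It|It] [It'|It'] tt'].
- exact: setUSS.
- by exists t' => //; left.
- by exists t' => //; right.
- exact: uq1.
- by case: (@J12F t'); [exact: J1c tt' (I1J1 _ It)|exact: I2J2].
- by case: (@J12F t'); [exact: I1J1|exact: J2c tt' (I2J2 _ It)].
- exact: uq2.
Qed.

(** * Solutions as functions constant on orbits *)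

Let p := b * xstar b.

Lemma fixed_point_xstar : p = xstar b + 1.
Proof. by rewrite /p /xstar; field; rewrite subr_eq0 lt_eqF. Qed.

(** The equation links two points only if both lie in [J]; closure keeps every intermediate point of
    the orbit in [J], so single steps can be chained. *)
Lemma solves_same_orbit (J : set R) (y : J -> R) : orbit_closed b p J ->
  solves b y -> forall u v : J, same_orbit b p (\val u) (\val v) -> y u = y v.
Proof.
move=> Jc ysol.
have iter n : forall u v : J, \val v - p = b ^+ n * (\val u - p) -> y u = y v.
  elim: n => [|n IHn] u v e.
    by congr y; apply: val_inj; move: e; rewrite expr0 mul1r => /addIr.
  have Jw : J (p + b ^+ n * (\val u - p)).
    by apply: Jc (set_mem (valP u)); exists n%:Z; rewrite -exprnP; ring.
  pose w : J := SigSub (mem_set Jw).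
  have -> : y u = y w by apply: IHn; rewrite /=; ring.
  (* With [x = w - 1], [x + 1] is [w] and [b * x] is [p + b * (w - p)], because
     [b * (p - 1) = p]. *)
  apply: (ysol (\val w - 1)); first by rewrite subrK.
  have bp : b * (p - 1) = p by rewrite {1}fixed_point_xstar addrK.
  by rewrite -(subrK p (\val v)) e exprS -[X in _ + X]bp /=; ring.
move=> u v [[n|n] e]; first exact: iter e.
(* A negative exponent is a positive one with [u] and [v] exchanged. *)
apply/esym/(iter n.+1); rewrite e NegzE -invr_expz -exprnP mulVKf//.
by rewrite gt_eqF ?exprn_gt0.
Qed.

Lemma same_orbit_solves (J : set R) (y : J -> R) :
  (forall u v : J, same_orbit b p (\val u) (\val v) -> y u = y v) ->
  solves b y.
Proof.
move=> yinv x u v eu ev; apply: yinv; exists 1.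
by rewrite eu ev expr1z {2}fixed_point_xstar /p; ring.
Qed.

(** The solution is [y0 \o rep], where [rep] sends a point to the representative of its orbit in
    [I]. Uniqueness of representatives makes [rep] constant on orbits and the identity on [I]. *)
Lemma ivp_exists_unique (J I : set R) (y0 : I -> R) :
  orbit_closed b p J -> transversal b p J I ->
  exists! y : J -> R, solves b y /\ agrees y y0.
Proof.
move=> Jc [IJ exI uqI].
have /choice[rep repP] (u : J) :
    exists i : I, same_orbit b p (\val u) (\val i).
  have [i Ii ui] := exI _ (set_mem (valP u)).
  by exists (SigSub (mem_set Ii)).
have rep_eq (u : J) (i : I) : same_orbit b p (\val u) (\val i) -> rep u = i.
  move=> ui; apply: val_inj; apply: uqI; try exact: set_mem (valP _).
  exact: same_orbit_trans (same_orbit_sym (repP u)) ui.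
exists (y0 \o rep); split=> [|z [zsol zy0]].
  split.
    apply: same_orbit_solves => u v uv /=; congr y0.
    by apply: rep_eq; apply: same_orbit_trans uv (repP v).
  move=> i; exists (SigSub (mem_set (IJ _ (set_mem (valP i))))) => //=.
  by congr y0; apply: rep_eq; exact: same_orbit_refl.
apply/funext => u /=; have [v vi <-] := zy0 (rep u).
apply/esym; apply: solves_same_orbit => //.
by rewrite vi; exact: repP.
Qed.

(** Glues two initial functions into one, reducing a problem with data on two intervals to
    [ivp_exists_unique]. *)
Lemma agreesU (J I1 I2 : set R) (f : I1 -> R) (g : I2 -> R) :
  I1 `&` I2 = set0 ->
  exists h : (I1 `|` I2) -> R, forall y : J -> R,
    agrees y h <-> agrees y f /\ agrees y g.
Proof.
move=> I12.
have I12F t : I1 t -> I2 t -> False.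
  by move=> I1t I2t; have : (I1 `&` I2) t by []; rewrite I12.
(* By disjointness one of the two conditions on [r] is vacuous at each [w]. *)
have /choice[h hP] (w : I1 `|` I2) : exists r : R,
    (forall i : I1, \val i = \val w -> f i = r) /\
    (forall i : I2, \val i = \val w -> g i = r).
  have [Iw|Iw] := set_mem (valP w).
    exists (f (SigSub (mem_set Iw))); split=> i iw.
      by congr f; exact: val_inj.
    by case: (I12F _ Iw); rewrite -iw; exact: set_mem (valP i).
  exists (g (SigSub (mem_set Iw))); split=> i iw.
    by case: (I12F (\val w)) => //; rewrite -iw; exact: set_mem (valP i).
  by congr g; exact: val_inj.
have hf (w : I1 `|` I2) (i : I1) : \val i = \val w -> f i = h w.
  by have [+ _] := hP w; exact.
have hg (w : I1 `|` I2) (i : I2) : \val i = \val w -> g i = h w.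
  by have [_] := hP w; exact.
exists h => y; split=> [yh|[yf yg] w].
  split=> i.
    have Ii : (I1 `|` I2) (\val i) by left; exact: set_mem (valP i).
    have [u ui yu] := yh (SigSub (mem_set Ii)).
    by exists u => //; rewrite yu; exact/esym/hf.
  have Ii : (I1 `|` I2) (\val i) by right; exact: set_mem (valP i).
  have [u ui yu] := yh (SigSub (mem_set Ii)).
  by exists u => //; rewrite yu; exact/esym/hg.
have [Iw|Iw] := set_mem (valP w).
  have [u uw yu] := yf (SigSub (mem_set Iw)).
  by exists u => //; rewrite yu; exact: hf.
have [u uw yu] := yg (SigSub (mem_set Iw)).
by exists u => //; rewrite yu; exact: hg.
Qed.

(** * The initial intervals as transversals *)

Lemma initial_interval_gt (x0 : R) : xstar b < x0 ->
  transversal b p `]p, +oo[ `[b * x0, x0 + 1[.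
Proof.
(* The radius is [r = x0 - xstar b]; the two ends use the two expressions [b * xstar b] and
   [xstar b + 1] for [p]. *)
move=> x0_gt; have -> : b * x0 = p + b * (x0 - xstar b) by rewrite /p; ring.
have -> : x0 + 1 = p + (x0 - xstar b) by rewrite fixed_point_xstar; ring.
by apply: transversal_gt; rewrite subr_gt0.
Qed.

Lemma initial_interval_lt (x0 : R) : x0 < xstar b ->
  transversal b p `]-oo, p[ `[x0 + 1, b * x0[.
Proof.
move=> x0_lt; have -> : b * x0 = p - b * (xstar b - x0) by rewrite /p; ring.
have -> : x0 + 1 = p - (xstar b - x0) by rewrite fixed_point_xstar; ring.
by apply: transversal_lt; rewrite subr_gt0.
Qed.

End Orbits.

Theorem theorem2p8 (R : realType) (b : R) (hb0 : 0 < b) (hb1 : b < 1) :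
  [/\ forall x0 : R, xstar b < x0 ->
        forall y0 : `[b * x0, x0 + 1[%classic -> R,
        exists! y : `]b * xstar b, +oo[%classic -> R,
          solves b y /\ agrees y y0,
      forall x0 : R, x0 < xstar b ->
        forall y0 : `[x0 + 1, b * x0[%classic -> R,
        exists! y : `]-oo, b * xstar b[%classic -> R,
          solves b y /\ agrees y y0
    & forall c d : R, c < xstar b -> xstar b < d ->
        forall (f : `[c + 1, b * c[%classic -> R)
               (g : `[b * d, d + 1[%classic -> R),
        exists! y : (~` [set b * xstar b]) -> R,
          [/\ solves b y, agrees y f & agrees y g]].
Proof.
set p := b * xstar b.
split=> [x0 x0_gt y0|x0 x0_lt y0|c d c_lt d_gt f g].
- apply: ivp_exists_unique => //; first exact: orbit_closed_gt.
  exact: initial_interval_gt.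
- apply: ivp_exists_unique => //; first exact: orbit_closed_lt.
  exact: initial_interval_lt.
(* The punctured line splits into two orbit-closed half-lines, each with its own transversal; the
   union of these carries the glued data. *)
have trf := initial_interval_lt hb0 hb1 c_lt.
have trg := initial_interval_gt hb0 hb1 d_gt.
have sides0 : `]-oo, p[ `&` `]p, +oo[ = set0 :> set R.
  apply/seteqP; split=> t //= []; rewrite !in_itv /= andbT => tp pt.
  by have := lt_trans tp pt; rewrite ltxx.
have sidesU : `]-oo, p[ `|` `]p, +oo[ = ~` [set p] :> set R.
  apply/seteqP; split=> t /=; rewrite !in_itv /= andbT.
    by case=> [tp|pt] e; [move: tp|move: pt]; rewrite e ltxx.
  by move=> /eqP; rewrite neq_lt => /orP.
have [If _ _] := trf; have [Ig _ _] := trg.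
have I0 : `[c + 1, b * c[ `&` `[b * d, d + 1[ = set0 :> set R.
  by rewrite -subset0 -sides0; exact: setISS.
have tr : transversal b p (~` [set p]) (`[c + 1, b * c[ `|` `[b * d, d + 1[).
  rewrite -sidesU; apply: transversalU => //.
    exact: orbit_closed_lt.
  exact: orbit_closed_gt.
have [h hP] := agreesU (~` [set p]) f g I0.
have [y [[ysol /hP[yf yg]] yuq]] :=
  ivp_exists_unique hb0 hb1 h (orbit_closed_neq hb0 (p := p)) tr.
exists y; split=> // z [zsol zf zg].
by apply: yuq; split=> //; apply/hP.
Qed.
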